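(* Let $a,k,d,e,f$ be integers with $1\le a\le k$, $1\le d\le k$, $1\le f\le d$, and either $e=d$ or $2e=d$. Let ${}_dB_{dk+e,\,da+f}(n)$ be the number of partitions of $n$ such that $$\phi_i+\phi_{i+1}<dk+e \ \text{ for all } i\ge 1,\qquad \phi_1<da+f,\qquad d\mid \phi_{2i}\ \text{ for all } i\ge 1.$$ Put $M=2dk+2e+d$. Then $\sum_{n\ge 0}{}_dB_{dk+e,\,da+f}(n)\,q^n$ equals: - if $f<e$: $$\frac{1}{(q^{2d};q^{2d})_\infty (q;q^2)_\infty}\left(\frac{1-q^{d-e+f}}{1-q^d}\,(q^{da+e},q^{2dk-da+e+d},q^{M};q^{M})_\infty+\frac{q^{d-e+f}-q^d}{1-q^d}\,(q^{d(a-1)+e},q^{2dk-da+e+2d},q^{M};q^{M})_\infty\right);$$ - if $f=e$: $$\frac{(q^{da+e},q^{2dk-da+e+d},q^{M};q^{M})_\infty}{(q^{2d};q^{2d})_\infty (q;q^2)_\infty};$$ - if $f>e$: $$\frac{1}{(q^{2d};q^{2d})_\infty (q;q^2)_\infty}\left(\frac{q^{f-e}-q^d}{1-q^d}\,(q^{da+e},q^{2dk-da+e+d},q^{M};q^{M})_\infty+\frac{1-q^{f-e}}{1-q^d}\,(q^{d(a+1)+e},q^{2dk-da+e},q^{M};q^{M})_\infty\right).$$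
   Context: A partition of a nonnegative integer $n$ is a finite non-increasing sequence of positive integers summing to $n$ (the empty partition is the unique partition of $0$). For a partition and an integer $i\ge1$, $\phi_i$ denotes the number of times $i$ occurs as a part (so $\phi_i\ge 0$). For $|q|<1$: $(a;q)_n=(1-a)(1-aq)\cdots(1-aq^{n-1})$, $(a;q)_\infty=\lim_{n\to\infty}(a;q)_n$, and $(a_1,\dots,a_r;q)_\infty=(a_1;q)_\infty\cdots(a_r;q)_\infty$. The identity is of formal power series in $q$ (equivalently of analytic functions for $|q|<1$). *)

(* Defs.v *)
From HB Require Import structures.
From mathcomp Require Import all_boot all_order all_algebra.
Set Implicit Arguments. Unset Strict Implicit. Unset Printing Implicit Defensive.
Import Order.TTheory GRing.Theory Num.Theory.
Local Open Scope ring_scope.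

(* formal power series in q with rational coefficients: n |-> coefficient of q^n *)
Definition ps := nat -> rat.

Definition psadd (f g : ps) : ps := fun n => f n + g n.
Definition psmul (f g : ps) : ps := fun n => \sum_(i < n.+1) f i * g (n - i)%N.
Definition pspoly (p : {poly rat}) : ps := fun n => p`_n.

(* multiplicative inverse of a power series with nonzero constant term:
   g_0 = 1/f_0,  g_n = -(1/f_0) * sum_{i=1..n} f_i g_{n-i}.
   psinv_seq f n = [:: g_0; ...; g_n]. *)
Fixpoint psinv_seq (f : ps) (n : nat) : seq rat :=
  match n with
  | 0 => [:: (f 0%N)^-1]
  | n'.+1 => let s := psinv_seq f n' in
      rcons s (- (f 0%N)^-1 * \sum_(i < n'.+1) f i.+1 * nth 0 s (n' - i)%N)
  end.
Definition psinv (f : ps) : ps := fun n => nth 0 (psinv_seq f n) n.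

(* (q^c ; q^m)_infty = prod_{j>=0} (1 - q^(c + j m)) as a formal power series.
   For c >= 1 and m >= 1, the factors with j > n do not affect the
   coefficient of q^n, so that coefficient is read off the finite product
   (q^c;q^m)_{n+1}. *)
Definition qpinf (c m : nat) : ps :=
  fun n => (\prod_(j < n.+1) (1 - 'X^(c + j * m)%N) : {poly rat})`_n.

Definition qp3 (c1 c2 m : nat) : ps :=
  psmul (qpinf c1 m) (psmul (qpinf c2 m) (qpinf m m)).

Definition is_partition (n : nat) (s : seq nat) : Prop :=
  sorted geq s /\ all (fun x => 0 < x)%N s /\ sumn s = n.

Definition phi (s : seq nat) (i : nat) : nat := count_mem i s.

Definition dB_cond (d K L : nat) (s : seq nat) : Prop :=
  (forall i, (1 <= i)%N -> (phi s i + phi s i.+1 < K)%N) /\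
  (phi s 1 < L)%N /\
  (forall i, (1 <= i)%N -> (d %| phi s (2 * i))%N).

(* Main.v *)
Require Import Defs.
From HB Require Import structures.
From mathcomp Require Import all_boot all_order all_algebra.
From mathcomp Require Import ring zify.
From Stdlib Require Import Setoid Morphisms.
Set Implicit Arguments. Unset Strict Implicit. Unset Printing Implicit Defensive.
Import Order.TTheory GRing.Theory Num.Theory.
Local Open Scope ring_scope.

(** Put K = dk + e and let A(N, S) be the generating function of the partitions with all
    parts > N, phi_i + phi_{i+1} < K, phi_{N+1} < S and d | phi_{2i}. Removing the parts
    N + 1 expresses A(N, S) through the A(N + 1, K - i), i < S. With
    D = (q^{2d}; q^{2d})_oo (q; q^2)_oo and w(N) the product of (1 - q^{di}) / (1 - q^i)
    over the odd i <= N, the series D w(N) A(N, S), for S = da + e (N even) or S = dm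
    (N odd), satisfy the recurrences of the Andrews functions J_{K/d, S/d}(x^d; q^d) at
    x = q^N, multiplied by (q^d; q^d)_oo:
      F(N, S) - F(N, S - d) = q^{(N+1)(S-d)} F(N + 1, K - S + d),
      F(N, -S) = - q^{-(N+1)S} F(N, S).
    Both sides agree in the limit N -> oo, hence for all N, and at N = 0 the Jacobi triple
    product turns the theta series F(0, da + e) into the infinite product. For f <> e, the
    generating function A(0, da + f) is interpolated linearly between two neighbouring
    A(0, da' + e). Power series identities are proved as polynomial identities modulo q^T. *)

(** * Congruence of polynomials modulo q^T, set up for rewriting *)

Definition eqt (T : nat) (p q : {poly rat}) := forall i, (i < T)%N -> p`_i = q`_i.

#[export] Instance eqt_equiv T : Equivalence (eqt T).
Proof.
split=> [p i //|p q pq i iT|p q r pq qr i iT]; first by rewrite pq.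
by rewrite pq // qr.
Qed.

#[export] Instance eqt_add T : Proper (eqt T ==> eqt T ==> eqt T) +%R.
Proof. by move=> p p' pp q q' qq i iT; rewrite !coefD pp // qq. Qed.

#[export] Instance eqt_opp T : Proper (eqt T ==> eqt T) -%R.
Proof. by move=> p p' pp i iT; rewrite !coefN pp. Qed.

#[export] Instance eqt_mul T : Proper (eqt T ==> eqt T ==> eqt T) *%R.
Proof.
move=> p p' pp q q' qq i iT; rewrite !coefM; apply: eq_bigr => j _.
by rewrite pp ?qq //; have := ltn_ord j; lia.
Qed.

Lemma eqt_sum T (I : Type) (r : seq I) (P : pred I) (E E' : I -> {poly rat}) :
  (forall i, P i -> eqt T (E i) (E' i)) ->
  eqt T (\sum_(i <- r | P i) E i) (\sum_(i <- r | P i) E' i).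
Proof.
move=> EE'; elim/big_ind2: _ => // p p' q q' pp qq.
by rewrite pp qq.
Qed.

Lemma eqtXn0 T n p : (T <= n)%N -> eqt T ('X^n * p) 0.
Proof. by move=> Tn i iT; rewrite coefXnM coef0 ifT //; lia. Qed.

Lemma eqt_1subXn T n : (T <= n)%N -> eqt T (1 - 'X^n) 1.
Proof.
move=> Tn; have := eqtXn0 1 Tn; rewrite mulr1 => ->.
by rewrite subr0.
Qed.

(** Induction on the coefficient: once the lower ones agree, the i-th coefficient of the product
    determines that of the factor, because the constant term of [u] is invertible. *)
Lemma eqt_mulI T (u p q : {poly rat}) : u`_0 != 0 -> eqt T (u * p) (u * q) -> eqt T p q.
Proof.
move=> u0 upq; elim/ltn_ind=> i IH iT.
have /(mulfI u0)// : u`_0 * p`_i = u`_0 * q`_i.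
have := upq i iT; rewrite !coefM !big_ord_recl !subn0 /=.
rewrite (eq_bigr (fun j : 'I_i => u`_(bump 0 j) * q`_(i - bump 0 j))) => [/addIr //|j _].
by rewrite IH //; have := ltn_ord j; rewrite /bump /=; lia.
Qed.

Lemma prod_1subXn_coef0 (n : nat) (E : nat -> nat) :
  (forall i, (0 < E i)%N) -> (\prod_(i < n) (1 - 'X^(E i)) : {poly rat})`_0 = 1.
Proof.
move=> E0; elim: n => [|n IH]; first by rewrite big_ord0 coef1.
rewrite big_ord_recr /= coefM big_ord_recl big_ord0 IH coefB coef1 coefXn.
by move: (E0 n); case: (E n) => // m _; rewrite /= subr0 !mulr1 addr0.
Qed.

(** Factors of index at least T are 1 modulo q^T, so both products reduce to their first T
    factors. *)
Lemma eqt_prod T m n (E : nat -> nat) :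
  (forall i, (i < E i)%N) -> (T <= m)%N -> (T <= n)%N ->
  eqt T (\prod_(i < m) (1 - 'X^(E i))) (\prod_(i < n) (1 - 'X^(E i))).
Proof.
move=> ltE Tm Tn.
have aux k : (T <= k)%N ->
  eqt T (\prod_(i < k) (1 - 'X^(E i))) (\prod_(i < T) (1 - 'X^(E i))).
  elim: k => [|k IH]; first by case: T {Tm Tn}.
  rewrite leq_eqVlt => /orP[/eqP-> //|Tk]; rewrite big_ord_recr /= IH //.
  by rewrite eqt_1subXn ?mulr1 //; move: (ltE k); lia.
by rewrite aux // [X in eqt _ _ X]aux.
Qed.

(** * Gaussian binomials and the Jacobi triple product *)

(** Gaussian binomial coefficient, given by the q-Pascal rule to avoid division. *)
Fixpoint qbin (R : comNzRingType) (x : R) (n j : nat) : R :=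
  match n, j with
  | _, 0 => 1
  | 0, _.+1 => 0
  | n'.+1, j'.+1 => x ^+ j * qbin x n' j + qbin x n' j'
  end.

Definition qfact (R : comNzRingType) (x : R) (n : nat) : R := \prod_(i < n) (1 - x ^+ i.+1).

Lemma qfactS (R : comNzRingType) (x : R) n : qfact x n.+1 = qfact x n * (1 - x ^+ n.+1).
Proof. by rewrite /qfact big_ord_recr. Qed.

Lemma qbin0 (R : comNzRingType) (x : R) n : qbin x n 0 = 1. Proof. by case: n. Qed.

Lemma qbinS (R : comNzRingType) (x : R) n j :
  qbin x n.+1 j.+1 = x ^+ j.+1 * qbin x n j.+1 + qbin x n j.
Proof. by []. Qed.

Lemma qbin_small (R : comNzRingType) (x : R) n j : (n < j)%N -> qbin x n j = 0.
Proof.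
elim: n j => [|n IH] [|j] //= nj.
by rewrite !IH ?mulr0 ?addr0 //; lia.
Qed.

(** The q-Pascal rule combined with 1 - x^(a+b+2) = x^(a+1) (1 - x^(b+1)) + (1 - x^(a+1)). *)
Lemma qbin_fact (R : comNzRingType) (x : R) a b :
  qbin x (a + b) a * qfact x a * qfact x b = qfact x (a + b).
Proof.
move: {2}(a + b)%N (erefl (a + b)%N) => n.
elim: n a b => [|n IH] [|a] [|b] //.
- by rewrite /qfact big_ord0 !mulr1.
- by rewrite add0n qbin0 /qfact big_ord0 !mul1r.
- rewrite addn0 => -[an]; rewrite qbinS qbin_small ?mulr0 ?add0r //.
  rewrite qfactS -[in RHS](addn0 a) -IH ?addn0 //.
  by rewrite /qfact big_ord0 !mulr1 -mulrA.
move=> abn.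
have := IH a b.+1 ltac:(lia); have := IH a.+1 b ltac:(lia).
rewrite addSn !addnS !addSn (qbinS x (a + b).+1) (qfactS x (a + b).+1).
move: (qfact x (a + b).+1) => P E1 E2.
transitivity (x ^+ a.+1 * (1 - x ^+ b.+1) * P + (1 - x ^+ a.+1) * P).
  by rewrite -{1}E1 -E2 !qfactS; ring.
by rewrite !exprS exprD; ring.
Qed.

(** Splitting off the factor y - z leaves the product for z x; the coefficients then combine by the
    q-Pascal rule. *)
Lemma gauss_binomial (R : comNzRingType) (x y z : R) n :
  \prod_(i < n) (y - z * x ^+ i) =
  \sum_(j < n.+1) (-1) ^+ j * x ^+ 'C(j, 2) * qbin x n j * z ^+ j * y ^+ (n - j).
Proof.
elim: n z => [|n IH] z.
  by rewrite big_ord0 big_ord1 /= bin0n !expr0 !mulr1.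
rewrite big_ord_recl expr0 mulr1.
under eq_bigr => i _ do rewrite [x ^+ _]exprS mulrA.
rewrite IH mulrBl !mulr_sumr [in RHS]big_ord_recl /=.
rewrite [in RHS](eq_bigr (fun j : 'I_n.+1 =>
   (-1) ^+ j.+1 * x ^+ 'C(j.+1, 2) * (x ^+ j.+1 * qbin x n j.+1) * z ^+ j.+1 * y ^+ (n - j)
   - z * ((-1) ^+ j * x ^+ 'C(j, 2) * qbin x n j * (z * x) ^+ j * y ^+ (n - j)))); last first.
  move=> j _; rewrite /bump /= !add1n subSS binS bin1 exprD !exprMn !exprS.
  by ring.
rewrite big_split /= sumrN addrA; congr (_ - _).
rewrite [in LHS]big_ord_recl [in RHS]big_ord_recr /= (@qbin_small _ x n n.+1) //.
rewrite !mulr0 !mul0r addr0 !subn0 !qbin0 bin0n !expr0 !mulr1 !mul1r -exprS; congr (_ + _).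
apply: eq_bigr => j _; rewrite /bump /= !add1n exprMn.
have -> : (n - j = (n - j.+1).+1)%N by case: j => j /=; lia.
by rewrite [y ^+ _.+1]exprS; ring.
Qed.

Lemma prod_XnM (n : nat) (E : nat -> nat) (p : nat -> {poly rat}) :
  \prod_(i < n) ('X^(E i) * p i) = 'X^(\sum_(i < n) E i) * \prod_(i < n) p i.
Proof.
elim: n => [|n IH]; first by rewrite !big_ord0 mul1r.
by rewrite !big_ord_recr /= IH exprD; ring.
Qed.

Lemma sum_ord_bin2 n : (\sum_(i < n) i = 'C(n, 2))%N.
Proof. by rewrite -bin2_sum big_mkord. Qed.

Lemma bin2D m n : 'C(m + n, 2) = ('C(m, 2) + 'C(n, 2) + m * n)%N.
Proof. by elim: n => [|n IH]; rewrite ?addnS ?binS ?bin1 ?IH ?addn0 /=; lia. Qed.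

(** This is [gauss_binomial] for 2m factors with y = q^(mM), z = q^p. Up to sign and a power of q,
    the first m factors give the product in r and the last m the product in p. The terms of index m
    - n and m + n + 1 form the two sums. *)
Lemma finite_jacobi p r m (M := (p + r)%N) (x := 'X^M : {poly rat}) :
  (\prod_(i < m) (1 - 'X^(p + i * M))) * (\prod_(i < m) (1 - 'X^(r + i * M))) =
  \sum_(n < m.+1) (-1) ^+ n * 'X^(M * 'C(n, 2) + r * n) * qbin x (m + m) (m - n) +
  \sum_(n < m) (-1) ^+ n.+1 * 'X^(M * 'C(n.+1, 2) + p * n.+1) * qbin x (m + m) (m + n.+1).
Proof.
have := gauss_binomial x ('X^(m * M)) 'X^p (m + m).
(* The power of q pulled out: m p + M C(m, 2) from the first m factors, m (m M) from the others. *)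
pose b := (m * p + M * 'C(m, 2) + m * (m * M))%N.
have -> : \prod_(i < m + m) ('X^(m * M) - 'X^p * x ^+ i) = (-1) ^+ m * 'X^b *
   ((\prod_(i < m) (1 - 'X^(p + i * M))) * (\prod_(i < m) (1 - 'X^(r + i * M)))).
  rewrite big_split_ord /=.
  have -> : \prod_(i < m) ('X^(m * M) - 'X^p * x ^+ i) =
     (-1) ^+ m * 'X^(m * p + M * 'C(m, 2)) * \prod_(i < m) (1 - 'X^(r + i * M)).
    rewrite (eq_bigr (fun i : 'I_m => - ('X^(p + M * i) * (1 - 'X^(r + (m - i.+1) * M))))).
      rewrite prodrN card_ord -!mulrA; congr (_ * _).
      rewrite (prod_XnM m (fun i => p + M * i)%N (fun i => 1 - 'X^(r + (m - i.+1) * M))).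
      rewrite big_split /= sum_nat_const card_ord -big_distrr /= sum_ord_bin2; congr (_ * _).
      by rewrite [RHS](reindex_inj rev_ord_inj).
    move=> i _; rewrite -exprM -exprD mulrBr mulr1 -exprD opprB; congr ('X^_ - _).
    have [c mc] : exists c, m = (i + c).+1.
      by exists (m - i.+1)%N; have := ltn_ord i; lia.
    have -> : (m - i.+1 = c)%N by lia.
    by move: (nat_of_ord i) mc => i' ->; rewrite /M; nia.
  rewrite [X in _ * X = _](eq_bigr (fun i : 'I_m => 'X^(m * M) * (1 - 'X^(p + i * M)))).
    rewrite (prod_XnM m (fun=> m * M)%N (fun i => 1 - 'X^(p + i * M))).
    by rewrite sum_nat_const card_ord /b !exprD; ring.
  by move=> i _; rewrite -exprM -exprD mulrBr mulr1 -exprD; congr (_ - 'X^_); lia.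
move=> E.
have nz : (-1) ^+ m * 'X^b != 0 :> {poly rat}.
  by rewrite mulf_neq0 ?signr_eq0 // monic_neq0 ?monicXn.
apply: (mulfI nz); rewrite E mulrDr !mulr_sumr -addSn big_split_ord /=.
congr (_ + _).
  rewrite (reindex_inj rev_ord_inj) /=; apply: eq_bigr => -[n /= nm] _.
  rewrite subSS -!exprM.
  have -> : (-1) ^+ (m - n) = (-1) ^+ m * (-1) ^+ n :> {poly rat}.
    by rewrite -signr_odd oddB // signr_addb !signr_odd.
  transitivity ((-1) ^+ m * (-1) ^+ n * qbin x (m + m) (m - n) *
    'X^(M * 'C(m - n, 2) + p * (m - n) + m * M * (m + m - (m - n)))).
    by rewrite !exprD; ring.
  have -> : (M * 'C(m - n, 2) + p * (m - n) + m * M * (m + m - (m - n)) =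
     b + (M * 'C(n, 2) + r * n))%N.
    rewrite /b; have [c mc] : exists c, m = (c + n)%N by exists (m - n)%N; lia.
    rewrite !{}mc.
    rewrite addnK bin2D (_ : (c + n + (c + n) - c = c + n + n)%N); last by lia.
    have : (n * n = 'C(n, 2) + 'C(n, 2) + n)%N.
      by elim: (n) => // k IH; rewrite binS bin1; nia.
    by rewrite /M; nia.
  by rewrite exprD; ring.
apply: eq_bigr => -[n /= nm] _; rewrite -!exprM addSnnS.
transitivity ((-1) ^+ m * (-1) ^+ n.+1 * qbin x (m + m) (m + n.+1) *
  'X^(M * 'C(m + n.+1, 2) + p * (m + n.+1) + m * M * (m + m - (m + n.+1)))).
  by rewrite !exprD; ring.
have -> : (M * 'C(m + n.+1, 2) + p * (m + n.+1) + m * M * (m + m - (m + n.+1)) =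
   b + (M * 'C(n.+1, 2) + p * n.+1))%N.
  rewrite /b bin2D; have [c mc] : exists c, m = (c + n.+1)%N by exists (m - n.+1)%N; lia.
  rewrite !{}mc.
  rewrite (_ : (c + n.+1 + (c + n.+1) - (c + n.+1 + n.+1) = c)%N); last by lia.
  by nia.
by rewrite exprD; ring.
Qed.

(** In the quotient formula all three q-factorials agree with [qfact 'X^M T] modulo q^T, and two of
    them cancel. *)
Lemma qbin_qfact_eqt T M a b : (0 < M)%N -> (T <= a)%N -> (T <= b)%N ->
  eqt T (qbin 'X^M (a + b) a * qfact 'X^M T) 1.
Proof.
move=> M0 Ta Tb.
have qfE n : qfact ('X^M : {poly rat}) n = \prod_(i < n) (1 - 'X^(M * i.+1)).
  by apply: eq_bigr => i _; rewrite exprM.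
have qft n : (T <= n)%N -> eqt T (qfact 'X^M n) (qfact 'X^M T).
  by move=> Tn; rewrite !qfE; apply: (@eqt_prod _ _ _ (fun i => M * i.+1)%N) => // i; nia.
apply: (@eqt_mulI _ (qfact 'X^M T)).
  by rewrite qfE (@prod_1subXn_coef0 _ (fun i => M * i.+1)%N) ?oner_eq0 // => i; nia.
rewrite mulr1 -{3}(qft (a + b)%N) -?qbin_fact; last by lia.
rewrite (qft a) // (qft b) // [X in eqt _ X](_ : _ =
  qbin 'X^M (a + b) a * qfact 'X^M T * qfact 'X^M T) //.
by rewrite mulrC.
Qed.

(** The limit of [finite_jacobi]: the binomials cancel against the third product, and the n-th terms
    of the two sums differ by the factor -q^(p(2n+1)). *)
Lemma jacobi_eqt T m p r (M := (p + r)%N) :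
  (0 < p)%N -> (0 < r)%N -> (T <= m)%N ->
  eqt T ((\prod_(i < m) (1 - 'X^(p + i * M))) *
         (* The right-hand side pairs the terms n and -n-1 of the bilateral theta series. *)
         ((\prod_(i < m) (1 - 'X^(r + i * M))) * (\prod_(i < m) (1 - 'X^(M + i * M)))))
    (\sum_(n < T) (-1) ^+ n * 'X^(M * 'C(n, 2) + r * n) * (1 - 'X^(p * (2 * n + 1)))).
Proof.
move=> p0 r0 Tm; pose h := (T + T)%N.
rewrite (@eqt_prod T m h (fun i => p + i * M)%N); [|by move=> i; nia|by []|by lia].
rewrite (@eqt_prod T m h (fun i => r + i * M)%N); [|by move=> i; nia|by []|by lia].
rewrite (@eqt_prod T m T (fun i => M + i * M)%N); [|by move=> i; nia|by []|by []].
rewrite mulrA finite_jacobi // -/M.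
have -> : \prod_(i < T) (1 - 'X^(M + i * M)) = qfact ('X^M : {poly rat}) T.
  by apply: eq_bigr => i _; rewrite -exprM; congr (1 - 'X^_); lia.
have term (c : {poly rat}) q a b (E : nat) n : (T <= E + q * n)%N \/ ((T <= a)%N /\ (T <= b)%N) ->
   eqt T (c * 'X^(E + q * n) * qbin 'X^M (a + b) a * qfact 'X^M T) (c * 'X^(E + q * n)).
  move=> [TE|[Ta Tb]].
    have Z u : eqt T (c * 'X^(E + q * n) * u) 0.
      by rewrite (mulrC c) -mulrA eqtXn0.
    by rewrite -mulrA Z -[c * _]mulr1 Z.
  have M0 : (0 < M)%N by rewrite /M; lia.
  by rewrite -mulrA qbin_qfact_eqt // mulr1.
rewrite mulrDl !mulr_suml.
transitivity (\sum_(n < h.+1) (-1) ^+ n * 'X^(M * 'C(n, 2) + r * n) +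
  \sum_(n < h) (-1) ^+ n.+1 * 'X^(M * 'C(n.+1, 2) + p * n.+1) : {poly rat}).
  apply: eqt_add; apply: eqt_sum => -[n /= nh] _.
    rewrite (_ : (h + h = (h - n) + (h + n))%N); last by lia.
    by apply: term; rewrite /h; case: (leqP n T) => nT; [right|left]; nia.
  rewrite (_ : (h + h = (h + n.+1) + (h - n.+1))%N); last by lia.
  by apply: term; rewrite /h; case: (ltnP n T) => nT; [right|left]; nia.
have cut (G : nat -> {poly rat}) l : (T <= l)%N ->
   (forall n, (T <= n)%N -> eqt T (G n) 0) -> eqt T (\sum_(n < l) G n) (\sum_(n < T) G n).
  move=> Tl G0; rewrite -(subnKC Tl) big_split_ord /= -[X in eqt _ _ X]addr0.
  apply: eqt_add => //; transitivity (\sum_(i < l - T) 0 : {poly rat}); last by rewrite big1.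
  by apply: eqt_sum => i _; apply: G0; lia.
have cut0 (c : {poly rat}) q (E : nat) n : (0 < q)%N -> (T <= n)%N -> eqt T (c * 'X^(E + q * n)) 0.
  by move=> q0 Tn; rewrite mulrC eqtXn0 //; nia.
rewrite (cut (fun n => (-1) ^+ n * 'X^(M * 'C(n, 2) + r * n))); [|by lia|by move=> *; apply: cut0].
rewrite (cut (fun n => (-1) ^+ n.+1 * 'X^(M * 'C(n.+1, 2) + p * n.+1)));
   [|by lia|by move=> *; apply: cut0 => //; lia].
rewrite -big_split /=; apply: eqt_sum => n _.
rewrite mulrBr mulr1 -[_ * _ * 'X^(p * _)]mulrA -exprD exprS mulN1r mulNr.
suff -> : (M * 'C(n.+1, 2) + p * n.+1 = M * 'C(n, 2) + r * n + p * (2 * n + 1))%N by [].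
by rewrite binS bin1 /M; nia.
Qed.

(** * Theta series and their recurrences *)

(* First T terms of F(N, S), where V stands for K + d - S; this keeps all exponents
   nonnegative without truncated subtraction. *)
Definition thetaN (d K T N S V : nat) : {poly rat} :=
  \sum_(n < T) (-1) ^+ n * 'X^(K * N * n + K * n ^ 2 + V * n + d * 'C(n, 2)) *
    (1 - 'X^(S * (N + 2 * n + 1))) * \prod_(i < N) (1 - 'X^(d * (n.+1 + i))).

Lemma thetaN0 d K T N V : thetaN d K T N 0 V = 0.
Proof. by apply: big1 => n _; rewrite mul0n expr0 subrr mulr0 mul0r. Qed.

Lemma prod_shift d N n : (1 - 'X^(d * n)) * \prod_(i < N) (1 - 'X^(d * (n.+1 + i))) =
  \prod_(i < N.+1) (1 - 'X^(d * (n + i))) :> {poly rat}.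
Proof.
rewrite big_ord_recl addn0; congr (_ * _); apply: eq_bigr => i _.
by rewrite lift0 addSnnS.
Qed.

Lemma eqt_sum_shift T (X Y : nat -> {poly rat}) : X 0%N = 0 -> eqt T (X T) 0 ->
  eqt T (\sum_(n < T) (X n + Y n)) (\sum_(n < T) (Y n + X n.+1)).
Proof.
move=> X0 XT; rewrite !big_split /= addrC; apply: eqt_add => //.
have := erefl (\sum_(i < T.+1) X i); rewrite {1}big_ord_recl big_ord_recr /= X0 add0r => ->.
by rewrite XT addr0.
Qed.

(** Telescoping: the n-th term is X_n + Y_n on the left and Y_n + X_(n+1) on the right. The boundary
    terms vanish, since P_0 contains the factor 1 - q^0 and X_T is divisible by q^T. *)
Lemma thetaN_shift d U V T N (K := (U + V)%N) : (0 < U + V)%N ->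
  eqt T (thetaN d K T N (U + d) V - thetaN d K T N U (V + d))
        ('X^(N.+1 * U) * thetaN d K T N.+1 V (U + d)).
Proof.
move=> K0; rewrite /thetaN -sumrB mulr_sumr.
pose P n := \prod_(i < N.+1) (1 - 'X^(d * (n + i))) : {poly rat}.
pose X n : {poly rat} :=
  (-1) ^+ n * 'X^(K * N * n + K * n ^ 2 + V * n + d * 'C(n, 2)) * P n.
pose Y n : {poly rat} := (-1) ^+ n *
  'X^(K * N * n + K * n ^ 2 + V * n + d * 'C(n, 2) + d * n + U * (N + 2 * n + 1)) * P n.+1.
rewrite (eq_bigr (fun n : 'I_T => X n + Y n)); last first.
  move=> [n nT] _ /=; rewrite /X /Y.
  have P1 : P n.+1 = (\prod_(i < N) (1 - 'X^(d * (n.+1 + i)))) * (1 - 'X^(d * (n.+1 + N))).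
    by rewrite /P big_ord_recr.
  rewrite P1 /P -prod_shift; move: (\prod_(i < N) _) => Q.
  have -> : ((U + d) * (N + 2 * n + 1) = U * (N + 2 * n + 1) + d * n + d * (n.+1 + N))%N by nia.
  have -> : ((V + d) * n = V * n + d * n)%N by nia.
  by rewrite !exprD; ring.
rewrite [X in eqt _ _ X](eq_bigr (fun n : 'I_T => Y n + X n.+1)); last first.
  move=> [n nT] _ /=; rewrite /X /Y -!/(P _) exprS mulN1r.
  move: (P n.+1) => Q.
  transitivity ((-1) ^+ n * Q * ('X^(N.+1 * U + (K * N.+1 * n + K * n ^ 2 + (U + d) * n +
     d * 'C(n, 2))) - 'X^(N.+1 * U + (K * N.+1 * n + K * n ^ 2 + (U + d) * n +
     d * 'C(n, 2)) + V * (N.+1 + 2 * n + 1)))); first by rewrite !exprD; ring.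
  have -> : (N.+1 * U + (K * N.+1 * n + K * n ^ 2 + (U + d) * n + d * 'C(n, 2)) +
     V * (N.+1 + 2 * n + 1) = K * N * n.+1 + K * n.+1 ^ 2 + V * n.+1 + d * 'C(n.+1, 2))%N.
    by rewrite binS bin1 /K; nia.
  have -> : (N.+1 * U + (K * N.+1 * n + K * n ^ 2 + (U + d) * n + d * 'C(n, 2)) =
     K * N * n + K * n ^ 2 + V * n + d * 'C(n, 2) + d * n + U * (N + 2 * n + 1))%N.
    by rewrite /K; nia.
  by ring.
apply: eqt_sum_shift.
  have P0 : P 0%N = 0 by rewrite /P big_ord_recl muln0 expr0 subrr mul0r.
  by rewrite /X P0 mulr0.
by rewrite /X [_ * 'X^_]mulrC -mulrA eqtXn0 //; nia.
Qed.

(* The shift relation at index S < d, with F(N, S - d) replaced by means of the symmetry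
   F(N, -S') = - q^{-(N+1)S'} F(N, S'). *)
Lemma thetaN_reflect d S S' K T N : (S + S' = d)%N -> (0 < K)%N ->
  eqt T ('X^(S' * N.+1) * thetaN d K T N S (K + S') + thetaN d K T N S' (K + S))
    (thetaN d K T N.+1 (K + S') S).
Proof.
move=> Sd K0; rewrite /thetaN mulr_sumr -big_split /=.
pose P n := \prod_(i < N.+1) (1 - 'X^(d * (n + i))) : {poly rat}.
(* The same telescoping as in [thetaN_shift]; [E] is the part of the exponent common to all
   terms. *)
pose E n := (K * N.+1 * n + K * n ^ 2 + d * 'C(n, 2))%N.
pose X n : {poly rat} := (-1) ^+ n * 'X^(E n + S' * (N + n + 1)) * P n.
pose Y n : {poly rat} := (-1) ^+ n * 'X^(E n + S * n) * P n.+1.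
rewrite (eq_bigr (fun n : 'I_T => X n + Y n)); last first.
  move=> [n nT] _ /=; rewrite /X /Y.
  have P1 : P n.+1 = (\prod_(i < N) (1 - 'X^(d * (n.+1 + i)))) * (1 - 'X^(d * (n.+1 + N))).
    by rewrite /P big_ord_recr.
  rewrite P1 /P -prod_shift; move: (\prod_(i < N) _) => Q.
  transitivity ((-1) ^+ n * Q * ('X^(E n + S' * (N + n + 1))
    - 'X^(E n + S * n + d * (n.+1 + N)) + 'X^(E n + S * n)
    - 'X^(E n + S' * (N + n + 1) + d * n))); last by rewrite !exprD; ring.
  have -> : (E n + S * n + d * (n.+1 + N) = S' * N.+1 + (K * N * n + K * n ^ 2 + (K + S') * n +
     d * 'C(n, 2)) + S * (N + 2 * n + 1))%N by rewrite /E -Sd; nia.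
  have -> : (E n + S' * (N + n + 1) + d * n = K * N * n + K * n ^ 2 + (K + S) * n +
     d * 'C(n, 2) + S' * (N + 2 * n + 1))%N by rewrite /E -Sd; nia.
  have -> : (E n + S' * (N + n + 1) = S' * N.+1 + (K * N * n + K * n ^ 2 + (K + S') * n +
     d * 'C(n, 2)))%N by rewrite /E; nia.
  have -> : (E n + S * n = K * N * n + K * n ^ 2 + (K + S) * n + d * 'C(n, 2))%N.
    by rewrite /E; nia.
  by rewrite !exprD; ring.
rewrite [X in eqt _ _ X](eq_bigr (fun n : 'I_T => Y n + X n.+1)); last first.
  move=> [n nT] _ /=; rewrite /X /Y -!/(P _) exprS mulN1r.
  move: (P n.+1) => Q.
  have -> : (E n.+1 + S' * (N + n.+1 + 1) = E n + S * n +
     (K + S') * (N.+1 + 2 * n + 1))%N by rewrite /E binS bin1 -Sd; nia.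
  have -> : (K * N.+1 * n + K * n ^ 2 + S * n + d * 'C(n, 2) = E n + S * n)%N.
    by rewrite /E; nia.
  by rewrite !exprD; ring.
apply: eqt_sum_shift.
  have P0 : P 0%N = 0 by rewrite /P big_ord_recl muln0 expr0 subrr mul0r.
  by rewrite /X P0 mulr0.
by rewrite /X [_ * 'X^_]mulrC -mulrA eqtXn0 // /E; nia.
Qed.

(** * Generating functions of the restricted partitions *)

(* A(N, S), restricted to the partitions with all parts at most N + j. *)
Fixpoint tailgf (d K j N S : nat) : {poly rat} :=
  if j is j'.+1 then
    \sum_(0 <= i < S | odd N ==> (d %| i)%N) 'X^(i * N.+1) * tailgf d K j' N.+1 (K - i)
  else (0 < S)%N%:R.

Definition tail_cond (d K j N S n : nat) (s : seq nat) : Prop :=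
  [/\ is_partition n s, all (fun x => N < x <= N + j)%N s,
      forall i, (N < i)%N -> (phi s i + phi s i.+1 < K)%N,
      (phi s N.+1 < S)%N &
      forall i, (N < i)%N -> ~~ odd i -> (d %| phi s i)%N].

Lemma tailgf0 d K j N : tailgf d K j N 0 = 0.
Proof. by case: j => [|j] //=; rewrite big_geq. Qed.

Lemma sumn_count (N : nat) (s : seq nat) :
  sumn s = (sumn [seq x <- s | x != N] + N * count_mem N s)%N.
Proof.
by elim: s => [|x s] /=; [lia|move=> ->; case: eqP => [->|_] /=; lia].
Qed.

Lemma geq_trans : ssrbool.transitive geq.
Proof. by move=> a b c /= ab bc; apply: leq_trans ab. Qed.

(** The smallest parts stand at the end, so removing them loses nothing but their number. *)
Lemma sorted_geq_split N s : sorted geq s -> all (leq N) s ->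
  s = [seq x <- s | x != N] ++ nseq (count_mem N s) N.
Proof.
elim: s => //= x s IH xs /andP[Nx Ns]; have ss := path_sorted xs.
case: eqP => [xN|_] /=; last by rewrite -IH.
have sN : all (pred1 N) s.
  apply/allP => y ys; rewrite /= eqn_leq (allP Ns) // andbT -xN.
  by move: xs; rewrite (path_sortedE geq_trans) => /andP[/allP/(_ y ys)].
have cs : count_mem N s = size s by apply/eqP; rewrite -all_count.
have f0 : [seq y <- s | y != N] = [::].
  have /eqP := congr1 size (IH ss Ns).
  by rewrite size_cat size_nseq cs -{1}[size s]add0n eqn_add2r => /eqP/esym/size0nil.
by rewrite f0 cs xN /= add0n -(all_pred1P _ _ sN).
Qed.

Lemma phi_filter N s i : phi [seq x <- s | x != N] i = if i == N then 0%N else phi s i.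
Proof.
rewrite /phi count_filter; case: eqP => [->|/eqP iN].
  by rewrite (eq_count (a2 := pred0)) ?count_pred0 // => x /=; case: eqP.
by apply: eq_count => x /=; case: eqP => [->|].
Qed.

Lemma phi_cat_nseq N s k i : phi (s ++ nseq k N) i = (phi s i + (N == i) * k)%N.
Proof. by rewrite /phi count_cat count_nseq. Qed.

Lemma filter_cat_nseq N (s : seq nat) k : all (fun x => x != N) s ->
  [seq x <- s ++ nseq k N | x != N] = s.
Proof.
move=> sN; rewrite filter_cat (all_filterP sN) [X in _ ++ X](_ : _ = [::]) ?cats0 //.
by elim: k => //= k ->; rewrite eqxx.
Qed.

(** Removing the parts N + 1 turns phi_{N+1} + phi_{N+2} < K into the bound K - phi_{N+1} on the new
    smallest multiplicity. *)
Lemma tail_cond_filter d K j N S n s : tail_cond d K j.+1 N S n s ->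
  [/\ tail_cond d K j N.+1 (K - phi s N.+1) (n - phi s N.+1 * N.+1)
        [seq x <- s | x != N.+1],
      (phi s N.+1 < S)%N, odd N ==> (d %| phi s N.+1)%N & (phi s N.+1 * N.+1 <= n)%N].
Proof.
move=> [[ss [sp sn]] sN sK sS sd].
have nE := sumn_count N.+1 s; rewrite -/(phi s N.+1) in nE.
split=> //; last 1 first.
- by lia.
- split.
  + split; first by apply: sorted_filter => //; apply: geq_trans.
    by split; [apply/allP => x; rewrite mem_filter => /andP[_ /(allP sp)]|lia].
  + apply/allP => x; rewrite mem_filter => /andP[xN /(allP sN)]; lia.
  + by move=> i Ni; rewrite !phi_filter !gtn_eqF ?sK //; lia.
  + by rewrite phi_filter gtn_eqF //; have := sK N.+1 (leqnn _); lia.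
  + by move=> i Ni io; rewrite phi_filter gtn_eqF // sd //; lia.
by apply/implyP => No; apply: sd; rewrite //= negbK.
Qed.

(** The inverse operation: k parts N + 1 are appended. *)
Lemma tail_cond_cat d K j N S n s k : (k < S)%N -> odd N ==> (d %| k)%N -> (k * N.+1 <= n)%N ->
  tail_cond d K j N.+1 (K - k) (n - k * N.+1) s ->
  tail_cond d K j.+1 N S n (s ++ nseq k N.+1) /\ all (fun x => x != N.+1) s.
Proof.
move=> kS kd kn [[ss [sp sn]] sN sK sS sd].
have sN' : all (fun x => x != N.+1) s by apply/allP => x /(allP sN); lia.
have phi0 : phi s N.+1 = 0%N.
  by apply/count_memPn/negP => /(allP sN'); rewrite eqxx.
split=> //; split.
- split.
    rewrite (sorted_pairwise geq_trans) pairwise_cat -!(sorted_pairwise geq_trans) ss.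
    apply/andP; split; last first.
      apply/(sortedP 0%N) => i; rewrite size_nseq => ik; rewrite !nth_nseq /=.
      by do 2![case: ifP => //]; lia.
    by apply/allrelP => x y /(allP sN) xN /nseqP[-> _] /=; lia.
  rewrite all_cat sp sumn_cat sn sumn_nseq; split; last by lia.
  by apply/allP => x /nseqP[->].
- by rewrite all_cat; apply/andP; split; apply/allP => x; [move/(allP sN)|move=> /nseqP[-> _]]; lia.
- move=> i Ni; rewrite !phi_cat_nseq; case: (eqVneq N.+1 i) => [<-|iN] /=.
    by rewrite phi0 ltn_eqF //=; lia.
  by rewrite ltn_eqF //=; have := sK i ltac:(lia); lia.
- by rewrite phi_cat_nseq phi0 eqxx; lia.
- move=> i Ni io; rewrite phi_cat_nseq; case: (eqVneq N.+1 i) => [iN|iN] /=.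
    by rewrite -iN phi0 add0n mul1n; move: io; rewrite -iN /= negbK => No; apply: (implyP kd).
  by rewrite mul0n addn0; apply: sd => //; lia.
Qed.

Lemma size_sum_count (T : Type) (f : T -> nat) (c : pred nat) S (l : seq T) :
  all (fun s => (f s < S)%N && c (f s)) l ->
  size l = (\sum_(0 <= i < S | c i) count (fun s => f s == i) l)%N.
Proof.
elim: l => [_|x l IH] /=; first by rewrite big1.
move=> /andP[/andP[xS xc] /IH->]; rewrite big_split /= -addn1 addnC; congr (_ + _)%N.
rewrite (eq_bigr (fun i => if i == f x then 1 else 0)%N); last first.
  by move=> i _; rewrite eq_sym; case: eqP.
rewrite -big_mkcondr big_mkord (bigD1 (Ordinal xS)) /=; last by rewrite xc eqxx.
by rewrite big1 // => i /andP[/andP[_ /eqP ix] /eqP[]]; apply: val_inj.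
Qed.

(** The partitions are sorted by the multiplicity i of N + 1; removing these parts is a bijection
    from each class onto the partitions counted by the i-th summand. For j = 0 only the empty
    partition remains. *)
Lemma size_tailgf d K j N S n l : (0 < K)%N -> uniq l ->
  (forall s, s \in l <-> tail_cond d K j N S n s) ->
  (size l)%:R = (tailgf d K j N S)`_n.
Proof.
move=> K0; elim: j N S n l => [|j IH] N S n l ul lP.
  have l0 s : s \in l -> s = [::].
    move=> /lP[_ sN _ _ _]; case: s sN => //= x s /andP[+ _]; lia.
  rewrite /= -[(0 < S)%N%:R]polyC_natr coefC.
  case: ifP => [/eqP n0|n0]; last first.
    case: l ul lP l0 => //= x l _ lP /(_ x (mem_head _ _)) x0.
    by have /lP[[_ [_ +]] _ _ _ _] := mem_head x l; rewrite x0 /= => n0'; rewrite -n0' in n0.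
  case: (posnP S) => S0.
    case: l ul lP l0 => //= x l _ lP _.
    by have /lP[_ _ _ + _] := mem_head x l; rewrite S0.
  have nl : [::] \in l by apply/lP; split=> //; rewrite n0.
  suff -> : l = [:: [::]] by [].
  apply/perm_small_eq => //; apply: uniq_perm => // s.
  by rewrite inE; apply/idP/eqP => [/l0|->].
rewrite (@size_sum_count _ (fun s => phi s N.+1) (fun i => odd N ==> (d %| i)%N) S); last first.
  by apply/allP => s /lP/tail_cond_filter[_ -> ->].
rewrite natr_sum coef_sum !big_mkord; apply: eq_bigr => -[i iS] /= ic.
rewrite coefXnM; case: ltnP => ni.
  apply/eqP; rewrite pnatr_eq0 -leqn0 leqNgt -has_count; apply/hasPn => s /lP.
  by move=> /tail_cond_filter[_ _ _]; case: eqP => // ->; lia.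
rewrite -size_filter -(size_map (fun s => [seq x <- s | x != N.+1])).
apply: IH => [|s].
  rewrite map_inj_in_uniq ?filter_uniq // => s t; rewrite !mem_filter.
  move=> /andP[/eqP si /lP[[ss _] sN _ _ _]] /andP[/eqP ti /lP[[st _] tN _ _ _]] E.
  have sN' : all (leq N.+1) s by apply: sub_all sN => x /= /andP[].
  have tN' : all (leq N.+1) t by apply: sub_all tN => x /= /andP[].
  have := sorted_geq_split st tN'; rewrite -/(phi t _) ti -E => ->.
  by have := sorted_geq_split ss sN'; rewrite -/(phi s _) si.
split=> [/mapP[t + ->]|sC].
  by rewrite mem_filter => /andP[/eqP <- /lP /tail_cond_filter[]].
have [tC sN] := tail_cond_cat iS ic ni sC.
apply/mapP; exists (s ++ nseq i N.+1); last by rewrite filter_cat_nseq.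
rewrite mem_filter; apply/andP; split; last by apply/lP.
rewrite phi_cat_nseq eqxx mul1n.
suff -> : phi s N.+1 = 0%N by rewrite add0n.
by apply/count_memPn/negP => /(allP sN); rewrite eqxx.
Qed.

(** * Recurrences of A(N, S) in S *)

Definition qnum (m N : nat) : {poly rat} := \sum_(i < m) 'X^(i * N).

Lemma qnumM m N : (1 - 'X^N) * qnum m N = 1 - 'X^(m * N).
Proof.
elim: m => [|m IH]; first by rewrite /qnum big_ord0 mulr0 expr0 subrr.
rewrite /qnum big_ord_recr /= mulrDr -/(qnum m N) IH mulSn exprD; ring.
Qed.

Lemma qnum_double e N : qnum (2 * e) N = (1 + 'X^(e * N)) * qnum e N.
Proof.
rewrite mul2n -addnn /qnum big_split_ord /= mulrDl mul1r mulr_sumr; congr (_ + _).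
by apply: eq_bigr => i _; rewrite mulnDl exprD.
Qed.

(** For odd N the multiplicity of N + 1 is a multiple of d, and no such multiple lies in [dm - i,
    dm). *)
Lemma tailgf_roundup d K j N m i : odd N -> (i < d)%N ->
  tailgf d K j N (d * m - i) = tailgf d K j N (d * m).
Proof.
move=> oN id; case: j => [|j] /=.
  by case: m => [|m]; rewrite ?muln0 ?sub0n // subn_gt0 mulnS ltn_addr //
    addn_gt0 (leq_ltn_trans _ id).
rewrite oN /= [RHS](@big_cat_nat _ _ _ (d * m - i)%N) //=; last by lia.
rewrite [X in _ = _ + X]big_nat_cond [X in _ = _ + X]big_pred0 ?addr0 // => x.
apply/negbTE/negP => /andP[/andP[x1 x2] /dvdnP[y xy]].
case: (ltnP y m) => ym; have := leq_mul (leqnn d) ym; first rewrite mulnS; lia.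
Qed.

(** The extra multiplicities da + e + x, x < i, leave the bound d(k - a) - x at N + 1, which rounds
    up to d(k - a). All of them thus share one tail, with a geometric sum in front. *)
Lemma tailgf_even d k e j N a i : ~~ odd N -> (i <= d)%N -> (a <= k)%N ->
  tailgf d (d * k + e) j.+1 N (d * a + e + i) =
  tailgf d (d * k + e) j.+1 N (d * a + e) +
  'X^((d * a + e) * N.+1) * qnum i N.+1 * tailgf d (d * k + e) j N.+1 (d * (k - a)).
Proof.
move=> oN id ak /=; rewrite (negbTE oN) /=.
rewrite [LHS](@big_cat_nat _ _ _ (d * a + e)%N) //=; last by lia.
congr (_ + _); rewrite -[X in index_iota X _]add0n big_addn addKn big_mkord.
rewrite /qnum mulr_sumr mulr_suml; apply: eq_bigr => -[x /= xi] _.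
rewrite -(@tailgf_roundup _ _ _ _ _ x) ?oN //=; last by lia.
by rewrite -exprD -mulnDl addnC mulnBr; congr (_ * tailgf _ _ _ _ _); lia.
Qed.

Lemma tailgf_even0 d k e j N : ~~ odd N -> (0 < e <= d)%N ->
  tailgf d (d * k + e) j.+1 N e = qnum e N.+1 * tailgf d (d * k + e) j N.+1 (d * k.+1).
Proof.
move=> oN ed /=; rewrite (negbTE oN) /= big_mkord /qnum mulr_suml.
apply: eq_bigr => -[x /= xi] _; rewrite -(@tailgf_roundup _ _ _ _ _ (d - e + x)) ?oN //=.
  by congr ('X^_ * tailgf _ _ _ _ _); nia.
by lia.
Qed.

Lemma tailgf_odd d k e j N m : odd N -> (0 < d)%N ->
  tailgf d (d * k + e) j.+1 N (d * m.+1) =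
  tailgf d (d * k + e) j.+1 N (d * m) +
  'X^(d * m * N.+1) * tailgf d (d * k + e) j N.+1 (d * k + e - d * m).
Proof.
(* Lowering the bound d(m + 1) to dm + 1 leaves a single new multiplicity, dm. *)
move=> oN d0; rewrite -(@tailgf_roundup _ _ _ _ m.+1 d.-1) //; last by lia.
rewrite (_ : (d * m.+1 - d.-1 = (d * m).+1)%N); last by nia.
by rewrite /= oN /= big_mkcond big_nat_recr //= dvdn_mulr // -big_mkcond.
Qed.

(** * Comparison of A(N, S) with the theta series *)

Definition denom (d H : nat) : {poly rat} :=
  (\prod_(i < H) (1 - 'X^(2 * d + i * (2 * d)))) * \prod_(i < H) (1 - 'X^(1 + i * 2)).

(* The polynomial w(N): the i-th factor is (1 - q^{d(i+1)}) / (1 - q^{i+1}). *)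
Definition weight (d N : nat) : {poly rat} := \prod_(i < N | ~~ odd i) qnum d i.+1.

Lemma weightS d N : weight d N.+1 = weight d N * (if odd N then 1 else qnum d N.+1).
Proof. by rewrite /weight big_mkcond big_ord_recr /= -big_mkcond if_neg. Qed.

(** The weight turns each 1 - q^i, i odd, into 1 - q^{di}; the factors in q^{2d} supply the even
    multiples of d. *)
Lemma denom_weight d H :
  denom d H * weight d (2 * H) = \prod_(i < 2 * H) (1 - 'X^(d * i.+1)).
Proof.
elim: H => [|H IH]; first by rewrite /denom /weight !big_ord0 !mulr1.
rewrite (_ : (2 * H.+1 = (2 * H).+2)%N); last by lia.
rewrite !weightS !big_ord_recr /= -{}IH /denom !big_ord_recr /= oddM /= mulr1.
rewrite -(qnumM d (2 * H).+1).
rewrite (_ : (1 + H * 2 = (2 * H).+1)%N); last by lia.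
rewrite (_ : (2 * d + H * (2 * d) = d * (2 * H).+2)%N); last by lia.
by ring.
Qed.

(** Terms with n > 0 carry q^(KNn), which vanishes modulo q^T for N >= T. *)
Lemma thetaN_large d K T N S V : (0 < K)%N -> (0 < S)%N -> (T <= N)%N ->
  eqt T (thetaN d K T N S V) (\prod_(i < N) (1 - 'X^(d * i.+1))).
Proof.
move=> K0 S0; case: T => // T TN; rewrite /thetaN big_ord_recl /=.
rewrite -[X in eqt _ _ X]addr0; apply: eqt_add.
  rewrite (_ : (K * N * 0 + _ + _ + _ = 0)%N) ?expr0 ?mul1r; last by rewrite !muln0.
  rewrite eqt_1subXn; last by nia.
  by rewrite mul1r; under eq_bigr => i _ do rewrite add1n.
transitivity (\sum_(i < T) 0 : {poly rat}); last by rewrite big1.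
apply: eqt_sum => i _; rewrite -!mulrA [_ * ('X^_ * _)]mulrCA eqtXn0 //.
by rewrite /bump /=; nia.
Qed.

(** Descending induction on N from 2H, where both sides equal the same product modulo q^T. At each N
    an inner induction raises S by d through the shift relation, from S = 0 for odd N and from S = e
    for even N. *)
Lemma denom_tailgf d k e H T j N :
  (0 < d)%N -> e = d \/ (2 * e)%N = d -> (T <= 2 * H)%N -> (N + j = 2 * H)%N ->
  let K := (d * k + e)%N in
  let ok S := eqt T (denom d H * weight d N * tailgf d K j N S)
                    (thetaN d K T N S (K + d - S)) in
  if odd N then forall m, (m <= k.+1)%N -> ok (d * m)%N
  else forall a, (a <= k.+1)%N -> ok (d * a + e)%N.
Proof.
move=> d0 ed TH + K.
have e0 : (0 < e <= d)%N by lia.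
have K0 : (0 < K)%N by rewrite /K; lia.
elim: j N => [|j IH] N Nj ok.
  rewrite /ok (_ : N = 2 * H)%N; last by lia.
  rewrite oddM /= => a ak; rewrite (_ : (0 < _)%N); last by lia.
  by rewrite mulr1 denom_weight thetaN_large //; lia.
have := IH N.+1 ltac:(lia); rewrite {IH}/ok weightS oddS if_neg.
case: (boolP (odd N)) => oN IH.
  elim=> [|m IHm] mk; first by rewrite muln0 thetaN0 tailgf0 mulr0.
  rewrite tailgf_odd // mulrDr IHm; last by lia.
  have := IH (k - m)%N ltac:(lia).
  rewrite (_ : (d * (k - m) + e = K - d * m)%N); last by rewrite /K mulnBr; nia.
  rewrite mulr1 => IH1.
  rewrite mulrCA {}IH1.
  have dmk : (d * m <= d * k)%N by rewrite leq_pmul2l.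
  have := @thetaN_shift d (d * m) (K - d * m) T N.
  rewrite subnKC; last by rewrite /K; lia.
  move=> /(_ K0).
  rewrite (_ : (K + d - (K - d * m) = d * m + d)%N); last by rewrite /K; lia.
  rewrite (_ : (K + d - (d * m) = K - d * m + d)%N); last by rewrite /K; lia.
  rewrite (_ : (K + d - (d * m.+1) = K - d * m)%N); last by rewrite /K; lia.
  rewrite (mulnS d m) (addnC d (d * m)) (mulnC _ N.+1) => <-.
  by rewrite addrC subrK.
elim=> [|a IHa] ak.
  rewrite muln0 add0n.
  have := IH k.+1 (leqnn _).
  have := @thetaN_reflect d e (d - e) K T N ltac:(lia) K0.
  rewrite (_ : (K + (d - e) = d * k.+1)%N); last by rewrite /K; lia.
  rewrite (_ : (K + d - d * k.+1 = e)%N); last by rewrite /K; lia.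
  rewrite (_ : (K + d - e = d * k.+1)%N); last by rewrite /K; lia.
  move=> <-; rewrite tailgf_even0 // -/K.
  (* The two choices of e enter here. If e = d, the second theta term has index 0 and vanishes. If
     2e = d, both theta terms are F(N, e), and their factor 1 + q^(e(N+1)) is the one in
     [qnum_double]. *)
  case: ed => [edd|ed]; first by rewrite !edd subnn mul0n expr0 mul1r thetaN0 addr0 !mulrA.
  rewrite (_ : (d - e = e)%N); last by lia.
  rewrite (_ : (K + e = d * k.+1)%N); last by rewrite /K; lia.
  rewrite -[in qnum d _]ed qnum_double => E.
  apply: (@eqt_mulI _ (1 + 'X^(e * N.+1))).
    have eN : (0 < e * N.+1)%N by rewrite muln_gt0; lia.
    by rewrite coefD coef1 coefXn (ltn_eqF eN) addr0 oner_eq0.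
  rewrite [X in eqt _ _ X]mulrDl mul1r [X in eqt _ _ X]addrC -E.
  suff -> : (1 + 'X^(e * N.+1)) * (denom d H * weight d N * (qnum e N.+1 *
    tailgf d K j N.+1 (d * k.+1))) = denom d H * (weight d N * ((1 + 'X^(e * N.+1)) *
    qnum e N.+1)) * tailgf d K j N.+1 (d * k.+1) by [].
  by ring.
rewrite (_ : (d * a.+1 + e = d * a + e + d)%N); last by lia.
rewrite tailgf_even // mulrDr IHa; last by lia.
have := IH (k - a)%N ltac:(lia) => IH1.
have dak : (d * a <= d * k)%N by rewrite leq_pmul2l.
rewrite [X in eqt _ (_ + X)](_ : _ = 'X^((d * a + e) * N.+1) *
  (denom d H * (weight d N * qnum d N.+1) * tailgf d K j N.+1 (d * (k - a)))); last by ring.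
rewrite {}IH1.
have := @thetaN_shift d (d * a + e) (d * (k - a)) T N.
rewrite mulnBr (_ : (d * a + e + (d * k - d * a) = K)%N); last by rewrite /K; lia.
move=> /(_ K0).
rewrite (_ : (K + d - (d * k - d * a) = d * a + e + d)%N); last by rewrite /K; lia.
rewrite (_ : (K + d - (d * a + e) = d * k - d * a + d)%N); last by rewrite /K; lia.
rewrite (_ : (K + d - (d * a + e + d) = d * k - d * a)%N); last by rewrite /K; lia.
rewrite (mulnC _ N.+1) => <-.
by rewrite addrC subrK.
Qed.

(** * Truncation of power series and return to the infinite products *)

Definition trunc (T : nat) (f : ps) : {poly rat} := \poly_(i < T) f i.

Lemma trunc_psadd T f g : eqt T (trunc T (psadd f g)) (trunc T f + trunc T g).
Proof. by move=> i iT; rewrite coefD !coef_poly iT. Qed.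

Lemma trunc_psmul T f g : eqt T (trunc T (psmul f g)) (trunc T f * trunc T g).
Proof.
move=> i iT; rewrite coefM coef_poly iT; apply: eq_bigr => j _.
by rewrite !coef_poly !ifT //; have := ltn_ord j; lia.
Qed.

Lemma trunc_pspoly T p : eqt T (trunc T (pspoly p)) p.
Proof. by move=> i iT; rewrite coef_poly iT. Qed.

Lemma trunc_qpinf T H c m : (0 < c)%N -> (0 < m)%N -> (T <= H)%N ->
  eqt T (trunc T (qpinf c m)) (\prod_(i < H) (1 - 'X^(c + i * m))).
Proof.
move=> c0 m0 TH i iT; rewrite coef_poly iT /qpinf.
by apply: (@eqt_prod i.+1 _ _ (fun j => c + j * m)%N) => // [j|]; nia.
Qed.

Lemma size_psinv_seq f n : size (psinv_seq f n) = n.+1.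
Proof. by elim: n => //= n IH; rewrite size_rcons IH. Qed.

Lemma nth_psinv_seq f n i : (i <= n)%N -> nth 0 (psinv_seq f n) i = psinv f i.
Proof.
elim: n => [|n IH]; first by case: i.
rewrite leq_eqVlt => /orP[/eqP-> //|i_n] /=.
by rewrite nth_rcons size_psinv_seq i_n IH.
Qed.

Lemma psinvS f n :
  psinv f n.+1 = - (f 0%N)^-1 * \sum_(i < n.+1) f i.+1 * psinv f (n - i)%N.
Proof.
rewrite {1}/psinv /= nth_rcons size_psinv_seq ltnn eqxx; congr (_ * _).
by apply: eq_bigr => i _; rewrite nth_psinv_seq // leq_subr.
Qed.

Lemma trunc_psinv T f : f 0%N != 0 -> eqt T (trunc T f * trunc T (psinv f)) 1.
Proof.
move=> f0 i iT; rewrite -(trunc_psmul f (psinv f) iT) coef_poly iT coef1 /psmul.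
rewrite big_ord_recl subn0; case: i {iT} => [|i].
  by rewrite big_ord0 addr0 /psinv /= divff.
rewrite psinvS mulrA mulrN divff // mulN1r addrC.
by apply/eqP; rewrite subr_eq0; apply/eqP; apply: eq_bigr => j _; rewrite lift0.
Qed.

(** [jacobi_eqt] with p = S and r = K + V; the exponents match because n^2 = 2 C(n, 2) + n. *)
Lemma thetaN_qp3 d K T S V : (S + V = K + d)%N -> (0 < S)%N -> (0 < K + V)%N ->
  eqt T (thetaN d K T 0 S V) (trunc T (qp3 S (K + V) (2 * K + d))).
Proof.
move=> SV S0 V0; have SM : (S + (K + V) = 2 * K + d)%N by lia.
rewrite /qp3 !trunc_psmul !(@trunc_qpinf _ T) //; try lia.
rewrite -SM jacobi_eqt // /thetaN; apply: eqt_sum => n _.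
rewrite big_ord0 mulr1 add0n SM.
suff -> : (K * 0 * n + K * n ^ 2 + V * n + d * 'C(n, 2) =
  (2 * K + d) * 'C(n, 2) + (K + V) * n)%N by [].
have : (n * n = 'C(n, 2) + 'C(n, 2) + n)%N.
  by elim: (nat_of_ord n) => // k IH; rewrite binS bin1; nia.
by nia.
Qed.

(** No part of a partition of n exceeds n, so the cap j is harmless. *)
Lemma dB_tail_cond d K L n j s : (n <= j)%N ->
  is_partition n s /\ dB_cond d K L s <-> tail_cond d K j 0 L n s.
Proof.
move=> nj; split=> [[sP [sK [sL sd]]]|[sP sN sK sL sd]].
  split=> // [|i i0 io]; last first.
    have -> : i = (2 * i./2)%N by rewrite mul2n even_halfK.
    by apply: sd; rewrite half_gt0; case: i i0 io => [|[]].
  have [_ [s0 sn]] := sP; apply/allP => x xs; rewrite (allP s0) //= add0n.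
  apply: leq_trans nj; rewrite -sn; elim: s xs {sP sK sL sd s0 sn} => //= y s IH.
  by rewrite inE => /orP[/eqP->|/IH]; lia.
split=> //; split=> //; split=> // i i0; apply: sd; first by lia.
by rewrite oddM.
Qed.

Lemma eqt_psmul_psinv d n A (X : ps) : (0 < d)%N ->
  eqt n.+1 (denom d n.+1 * A) (trunc n.+1 X) ->
  A`_n = psmul (psinv (psmul (qpinf (2 * d) (2 * d)) (qpinf 1 2))) X n.
Proof.
move=> d0 E; set D := psmul (qpinf _ _) _.
have ED : eqt n.+1 (trunc n.+1 D) (denom d n.+1).
  by rewrite trunc_psmul !(@trunc_qpinf _ n.+1) //; lia.
have D0 : (denom d n.+1)`_0 = 1.
  rewrite /denom coefM big_ord1 /=.
  rewrite (@prod_1subXn_coef0 _ (fun i => 2 * d + i * (2 * d))%N); last by lia.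
  by rewrite (@prod_1subXn_coef0 _ (fun i => 1 + i * 2)%N) ?mulr1.
have D0' : D 0%N != 0.
  by have := ED 0%N isT; rewrite coef_poly D0 /= => ->; rewrite oner_eq0.
suff : eqt n.+1 A (trunc n.+1 (psinv D) * trunc n.+1 X).
  move=> /(_ n (leqnn _)) ->.
  by rewrite -(trunc_psmul _ _ (leqnn _)) coef_poly leqnn.
apply: (@eqt_mulI _ (denom d n.+1)); first by rewrite D0 oner_eq0.
by rewrite E -ED mulrA trunc_psinv // mul1r.
Qed.

(** * Interpolation in f and conclusion *)

(** By [tailgf_even] at N = 0, raising S from da + e by i adds a fixed multiple of (1 - q^i) / (1 -
    q); comparison with i = d eliminates the common tail. *)
Lemma tailgf_avg d k e j a i (K := (d * k + e)%N) :
  (i <= d)%N -> (a <= k)%N ->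
  (1 - 'X^d) * tailgf d K j.+1 0 (d * a + e + i) =
  ('X^i - 'X^d) * tailgf d K j.+1 0 (d * a + e) +
  (1 - 'X^i) * tailgf d K j.+1 0 (d * a.+1 + e).
Proof.
move=> id ak.
rewrite (_ : (d * a.+1 + e = d * a + e + d)%N); last by lia.
rewrite !tailgf_even // -/K muln1.
have nz : 1 - 'X != 0 :> {poly rat} by rewrite -oppr_eq0 opprB polyXsubC_eq0.
have := qnumM i 1; have := qnumM d 1; rewrite expr1 !muln1 => Ed Ei.
apply: (mulfI nz).
move: (tailgf d K j.+1 0 _) (tailgf d K j 1 _) ('X^(d * a + e) : {poly rat}) => A0 C Y.
transitivity ((1 - 'X^d) * ((1 - 'X) * A0 + Y * ((1 - 'X) * qnum i 1) * C)); first by ring.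
rewrite Ei; transitivity ((1 - 'X) * (1 - 'X^d) * A0 + (1 - 'X^i) * Y * (1 - 'X^d) * C).
  by ring.
by rewrite -{2}Ed; ring.
Qed.

Lemma eqt_psinv_avg d T (p q D A A0 A1 : {poly rat}) (X0 X1 : ps)
    (iD := psinv (pspoly (1 - 'X^d))) : (0 < d)%N ->
  (1 - 'X^d) * A = p * A0 + q * A1 ->
  eqt T (D * A0) (trunc T X0) -> eqt T (D * A1) (trunc T X1) ->
  eqt T (D * A) (trunc T (psadd (psmul (pspoly p) (psmul iD X0))
                                (psmul (pspoly q) (psmul iD X1)))).
Proof.
move=> d0 EA E0 E1.
have u0 : (1 - 'X^d : {poly rat})`_0 != 0.
  by rewrite coefB coef1 coefXn (ltn_eqF d0) subr0 oner_eq0.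
have EI : eqt T ((1 - 'X^d) * trunc T iD) 1.
  by rewrite -{1}(trunc_pspoly (T := T) (1 - 'X^d)) trunc_psinv.
apply: (@eqt_mulI _ (1 - 'X^d)) => //.
rewrite trunc_psadd !trunc_psmul !trunc_pspoly.
rewrite [X in eqt _ _ X](_ : _ = (1 - 'X^d) * trunc T iD * (p * trunc T X0 + q * trunc T X1));
  last by ring.
rewrite EI mul1r mulrCA EA mulrDr mulrCA E0 mulrCA E1.
by [].
Qed.

(* For each n, l is any duplicate-free list enumerating exactly the partitions
   counted by _dB_{dk+e,da+f}(n), so  size l = _dB_{dk+e,da+f}(n). *)
Theorem theorem3p1 (a k d e f : nat) :
  (1 <= a <= k)%N -> (1 <= d <= k)%N -> (1 <= f <= d)%N ->
  (e = d \/ (2 * e)%N = d) ->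
  let M := (2 * d * k + 2 * e + d)%N in
  let P := psinv (psmul (qpinf (2 * d) (2 * d)) (qpinf 1 2)) in
  let T0 := qp3 (d * a + e) (2 * d * k - d * a + e + d) M in
  let iD := psinv (pspoly (1 - 'X^d)) in
  forall (n : nat) (l : seq (seq nat)),
    uniq l ->
    (forall s, s \in l <-> is_partition n s /\ dB_cond d (d * k + e) (d * a + f) s) ->
    ((f < e)%N ->
       (size l)%:R =
       psmul P
         (psadd
            (psmul (pspoly (1 - 'X^(d - e + f))) (psmul iD T0))
            (psmul (pspoly ('X^(d - e + f) - 'X^d))
               (psmul iD (qp3 (d * (a - 1) + e) (2 * d * k - d * a + e + 2 * d) M)))) n)
    /\
    (f = e -> (size l)%:R = psmul P T0 n)
    /\
    ((e < f)%N ->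
       (size l)%:R =
       psmul P
         (psadd
            (psmul (pspoly ('X^(f - e) - 'X^d)) (psmul iD T0))
            (psmul (pspoly (1 - 'X^(f - e)))
               (psmul iD (qp3 (d * (a + 1) + e) (2 * d * k - d * a + e) M)))) n).
Proof.
move=> /andP[a0 ak] /andP[d0 dk] /andP[f0 fd] ed M P T0 iD n l ul lP.
(* The cap 2(n + 1) exceeds n and is the even number 2H, with H = n + 1, at which [denom_tailgf]
   starts. *)
pose K := (d * k + e)%N; pose A L := tailgf d K (2 * n.+1) 0 L.
have jE : (2 * n.+1 = (2 * n).+2)%N by lia.
have e0 : (0 < e <= d)%N by lia.
have -> : (size l)%:R = (A (d * a + f)%N)`_n.
  apply: size_tailgf => // [|s]; first by rewrite /K; lia.
  by rewrite lP; apply: dB_tail_cond; lia.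
(* The range reaches b = k + 1, as needed for a + 1 when a = k. *)
have main b c : (b <= k.+1)%N -> (c + d * b = 2 * d * k + e + d)%N ->
    eqt n.+1 (denom d n.+1 * A (d * b + e)%N) (trunc n.+1 (qp3 (d * b + e) c M)).
  move=> bk cE; have dbk : (d * b <= d * k.+1)%N by rewrite leq_pmul2l.
  have := @denom_tailgf d k e n.+1 n.+1 (2 * n.+1) 0 d0 ed ltac:(lia) ltac:(lia).
  move=> /(_ b bk); rewrite -/K /weight big_ord0 mulr1 => ->.
  rewrite (@thetaN_qp3 _ _ _ _ (K + d - (d * b + e))); try by rewrite /K; lia.
  rewrite (_ : (K + (K + d - (d * b + e)) = c)%N); last by rewrite /K; lia.
  by rewrite (_ : (2 * K + d = M)%N) // /K /M; lia.
have dak : (d * a <= d * k)%N by rewrite leq_pmul2l.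
have Ea : eqt n.+1 (denom d n.+1 * A (d * a + e)%N) (trunc n.+1 T0) by apply: main; lia.
split=> [fe|]; [|split=> [->|ef]].
- apply: eqt_psmul_psinv => //; apply: eqt_psinv_avg Ea (main (a - 1)%N _ _ _) => //.
  (* For f < e the bound lies between d(a - 1) + e and da + e. *)
  + rewrite /A jE /K (_ : (d * a + f = d * (a - 1) + e + (d - e + f))%N); last by nia.
    by rewrite tailgf_avg; [rewrite subn1 prednK // addrC|lia|lia].
  + by lia.
  + by nia.
- exact: eqt_psmul_psinv Ea.
- apply: eqt_psmul_psinv => //; apply: eqt_psinv_avg Ea (main (a + 1)%N _ _ _) => //.
  (* For f > e it lies between da + e and d(a + 1) + e. *)
  + rewrite /A jE /K (_ : (d * a + f = d * a + e + (f - e))%N); last by lia.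
    by rewrite tailgf_avg; [rewrite addn1|lia|lia].
  + by lia.
  + by lia.
Qed.
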